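(* Let $\Omega$ be a topological space, let $T_1,\dots,T_\gamma:\Omega\to\Omega$ be commuting homeomorphisms, write $T^n=T_1^{n_1}\cdots T_\gamma^{n_\gamma}$ for $n\in\mathbb{Z}^\gamma$, and let $\mu$ be a Borel measure on $\Omega$ that is ergodic for this $\mathbb{Z}^\gamma$-action. Let $f:\Omega\to\mathbb{R}$ be continuous and for $\omega\in\Omega$ define the operator $H_\omega$ on $\ell^2(\mathbb{Z}^\gamma)$ by $(H_\omega u)(n)=\sum_{|m-n|=1}u(m)+f(T^n\omega)u(n)$. If $H_\omega$ has uniformly localized eigenfunctions (ULE) for all $\omega$ in a set of positive $\mu$-measure, then $H_\omega$ has homogeneous ULE in $\operatorname{supp}(\mu)$: there exist constants $\alpha>0$ and $C>0$, independent of $\omega$, such that for every $\omega\in\operatorname{supp}(\mu)$, $H_\omega$ has a complete orthonormal set of eigenfunctions $\{\phi^\omega_n\}_{n\ge1}$ and points $m^\omega_n\in\mathbb{Z}^\gamma$ with $|\phi^\omega_n(m)|\le Ce^{-\alpha|m-m^\omega_n|}$ for all $n$ and all $m\in\mathbb{Z}^\gamma$.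
   Context: $|\cdot|$ denotes the norm on $\mathbb{Z}^\gamma$ (with $|m-n|=1$ meaning nearest neighbours). A self-adjoint operator $H$ on $\ell^2(\mathbb{Z}^\gamma)$ has uniformly localized eigenfunctions (ULE) if it has a complete orthonormal set of eigenfunctions $\{\phi_n\}_{n\ge1}$ and there exist $\alpha>0$, $C>0$ and points $m_n\in\mathbb{Z}^\gamma$ such that $|\phi_n(m)|\le Ce^{-\alpha|m-m_n|}$ for all $n$ and all $m$. Homogeneous ULE in a set $S$ means ULE holds for every $\omega\in S$ with constants $C,\alpha$ not depending on $\omega$. *)

(* Defs.v *)
From HB Require Import structures.
From mathcomp Require Import all_boot all_order all_algebra.
From mathcomp Require Import all_classical all_reals all_analysis.
From mathcomp Require Import complex.
Set Implicit Arguments. Unset Strict Implicit. Unset Printing Implicit Defensive.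
Import Order.TTheory GRing.Theory Num.Theory numFieldTopology.Exports numFieldNormedType.Exports.
Local Open Scope classical_set_scope.
Local Open Scope ring_scope.

Definition Zg (g : nat) := {ffun 'I_g -> int}.

Definition unitv (g : nat) (i : 'I_g) : Zg g := [ffun j => ((j == i) : nat)%:Z].

Definition l1norm (g : nat) (n : Zg g) : int := \sum_(i < g) `|n i|%:Z.

Definition zpow (X : Type) (S Sinv : X -> X) (k : int) : X -> X :=
  match k with
  | Posz p => iter p S
  | Negz p => iter p.+1 Sinv
  end.

Definition zact (X : Type) (g : nat) (T Tinv : 'I_g -> X -> X) (n : Zg g) (x : X) : X :=
  foldr (fun i y => zpow (T i) (Tinv i) (n i) y) x (enum 'I_g).

(* The operator H_omega acting on functions Z^g -> C (defined pointwise):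
   (H u)(n) = sum_{|m-n|=1} u(m) + f(T^n omega) u(n); the neighbours of n
   are exactly n + e_i and n - e_i. *)
Definition Hop (R : realType) (X : Type) (g : nat) (T Tinv : 'I_g -> X -> X)
  (f : X -> R) (w : X) (u : Zg g -> R[i]) : Zg g -> R[i] :=
  fun n => (\sum_(i < g) (u (n + unitv i) + u (n - unitv i)))
           + (f (zact T Tinv n w))%:C%C * u n.

Definition rsum (R : realType) (g : nat) (a : Zg g -> R) : R :=
  fine (esum setT (fun m => (Num.max (a m) 0)%:E))
  - fine (esum setT (fun m => (Num.max (- a m) 0)%:E)).

Definition csum (R : realType) (g : nat) (a : Zg g -> R[i]) : R[i] :=
  Complex (rsum (fun m => complex.Re (a m))) (rsum (fun m => complex.Im (a m))).

Definition is_l2 (R : realType) (g : nat) (u : Zg g -> R[i]) : Prop :=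
  (esum setT (fun m => ((Normc.normc (u m)) ^+ 2)%:E) < +oo)%E.

Definition inner (R : realType) (g : nat) (u v : Zg g -> R[i]) : R[i] :=
  csum (fun m => u m * conjc (v m)).

Definition eigenfunction (R : realType) (g : nat)
  (H : (Zg g -> R[i]) -> (Zg g -> R[i])) (phi : Zg g -> R[i]) : Prop :=
  is_l2 phi /\ phi <> (fun _ => 0) /\ exists E : R[i], forall n, H phi n = E * phi n.

Definition complete_orthonormal (R : realType) (g : nat) (phi : nat -> Zg g -> R[i]) : Prop :=
  (forall k, is_l2 (phi k)) /\
  (forall k l, inner (phi k) (phi l) = (if k == l then 1 else 0)) /\
  (forall u, is_l2 u -> (forall k, inner u (phi k) = 0) -> u = (fun _ => 0)).

Definition ULE_with (R : realType) (g : nat)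
  (H : (Zg g -> R[i]) -> (Zg g -> R[i])) (alpha C : R) : Prop :=
  exists (phi : nat -> Zg g -> R[i]) (c : nat -> Zg g),
    complete_orthonormal phi /\ (forall k, eigenfunction H (phi k)) /\
    (forall k m, Normc.normc (phi k m) <= C * expR (- alpha * (l1norm (m - c k))%:~R)).

Definition ULE (R : realType) (g : nat) (H : (Zg g -> R[i]) -> (Zg g -> R[i])) : Prop :=
  exists alpha C : R, 0 < alpha /\ 0 < C /\ ULE_with H alpha C.

Definition msupport (R : realType) (X : ptopologicalType)
  (mu : set (g_sigma_algebraType (@open X)) -> \bar R) : set X :=
  [set x | forall U : set X, open U -> U x -> (0 < mu U)%E].

Definition ergodic (R : realType) (X : ptopologicalType) (g : nat)
  (T : 'I_g -> X -> X) (mu : set (g_sigma_algebraType (@open X)) -> \bar R) : Prop :=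
  (forall i (A : set (g_sigma_algebraType (@open X))), measurable A ->
     mu (T i @^-1` A) = mu A) /\
  (forall A : set (g_sigma_algebraType (@open X)), measurable A ->
     (forall i, T i @^-1` A = A) -> mu A = 0%E \/ mu (~` A) = 0%E).

(* Main.v *)
(* If an operator has ULE with constants alpha and C, its eigenfunctions can be
   indexed by Z^g x {1..N}: the first component is the localization centre and
   N bounds, in terms of alpha and C only, how many eigenfunctions share a
   centre (each of them puts half of its mass in a fixed ball around the
   centre, and sum_k |phi_k(n)|^2 <= 1 at each site n).  The
   orthonormality and completeness relations, the latter in the form
   sum_k phi_k(n) conj(phi_k(m)) = delta_nm, are then sums with a fixed summable
   exponential majorant, so they pass, together with the pointwise eigenvalue
   equation, to limits along an ultrafilter of potentials converging pointwise.
   Hence the set of omega for which H_omega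
   has ULE with given constants is closed.  It is also invariant under every
   T_i, so by ergodicity it is null or conull.  Countably many of these sets
   cover the given set of positive measure, so one of them is conull, and being
   closed it contains supp(mu). *)

Require Import Defs.
From HB Require Import structures.
From mathcomp Require Import all_boot all_order all_algebra.
From mathcomp Require Import all_classical all_reals all_analysis.
From mathcomp Require Import complex finmap.
From mathcomp Require Import ring lra.
From mathcomp.analysis.showcase Require Import summability.
Import Order.TTheory GRing.Theory Num.Theory numFieldTopology.Exports numFieldNormedType.Exports.
Local Open Scope classical_set_scope.
Local Open Scope ring_scope.


(** * Limits along a filter in a numeric field *)

Section Limits.
Context {K : numFieldType} {X : Type}.
Implicit Types (F : set_system X) (h k : X -> K) (l m : K).

(* Stated on an abstract numFieldType so that it can be used on R[i], where
   the topology is not found by direct unification. *)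
Definition tends F h l : Prop := h @ F --> l.

Lemma tendsP {F} {FF : Filter F} h l :
  tends F h l <-> forall e, 0 < e -> F [set x | `|l - h x| <= e].
Proof. by split => [/cvgrPdist_le|H]; [|apply/cvgrPdist_le]. Qed.

Lemma tends_cst {F} {FF : Filter F} l : tends F (fun=> l) l.
Proof. exact: cvg_cst. Qed.

Lemma tendsD {F} {FF : Filter F} h k l m :
  tends F h l -> tends F k m -> tends F (fun x => h x + k x) (l + m).
Proof. by move=> a b; apply: cvgD. Qed.

Lemma tendsB {F} {FF : Filter F} h k l m :
  tends F h l -> tends F k m -> tends F (fun x => h x - k x) (l - m).
Proof. by move=> a b; apply: cvgB. Qed.

Lemma tendsM {F} {FF : Filter F} h k l m :
  tends F h l -> tends F k m -> tends F (fun x => h x * k x) (l * m).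
Proof. by move=> a b; apply: cvgM. Qed.

Lemma tends_sum {F} {FF : Filter F} (I : Type) (s : seq I) (h : I -> X -> K) (l : I -> K) :
  (forall i, tends F (h i) (l i)) ->
  tends F (fun x => \sum_(i <- s) h i x) (\sum_(i <- s) l i).
Proof.
move=> H; elim: s => [|i s IH].
  by rewrite big_nil; under eq_fun do rewrite big_nil; exact: tends_cst.
rewrite big_cons; under eq_fun do rewrite big_cons.
exact: tendsD.
Qed.

Lemma tends_near {F} {FF : Filter F} h k l :
  F [set x | h x = k x] -> tends F h l -> tends F k l.
Proof.
move=> E /tendsP H; apply/tendsP => e e0; apply: filterS2 (H e e0) E.
by move=> x /= A <-.
Qed.

Lemma tends_unique {F} {FF : ProperFilter F} h l m : tends F h l -> tends F h m -> l = m.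
Proof. by move=> a b; apply: (cvg_unique _ a b). Qed.

(** The order of [K] is only partial, as on [R[i]]. Eventually [k] equals its own norm, so [m]
    equals its norm too and the usual epsilon argument becomes available. *)
Lemma tends_norm_le {F} {FF : ProperFilter F} h k l m :
  F [set x | `|h x| <= k x] -> tends F h l -> tends F k m -> `|l| <= m.
Proof.
move=> le hl km.
have nk : tends F (fun x => `|k x|) `|m| by apply: cvg_norm.
have -> : m = `|m|.
  apply: tends_unique km _; apply: tends_near nk.
  by apply: filterS le => x /= /(le_trans (normr_ge0 _)) /ger0_norm.
apply/ler_addgt0Pr => e e0; have e20 : 0 < e / 2 by rewrite divr_gt0.
have H1 : F [set x | `|l - h x| <= e / 2] by move/tendsP: hl; apply.
have H2 : F [set x | `|m - k x| <= e / 2] by move/tendsP: km; apply.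
have [x [[/= {}H1 {}H2] H3]] := filter_ex (filterI (filterI H1 H2) le).
have -> : l = (l - h x) + h x by rewrite subrK.
apply: le_trans (ler_normD _ _) _; rewrite [e]splitr addrCA lerD //.
apply: (le_trans H3); rewrite -[k x]ger0_norm; last exact: le_trans H3.
have -> : k x = m - (m - k x) by rewrite subKr.
by apply: le_trans (ler_normB _ _) _; rewrite lerD2l.
Qed.

End Limits.

(* Unconditional sums: tails, dominated limits and exchange *)
#[local] Existing Instance totally_filter.

Section UnconditionalSums.
Context {K : numFieldType} {T : choiceType}.
Implicit Types (a b : T -> K) (s : K) (G : {fset T}).

(** Convergence along the finite subsets ordered by inclusion. No enumeration of the index set
    enters, so reindexing and double sums stay elementary, for real and complex families alike. *)
Definition has_sum a s : Prop :=
  tends totally (fun G : {fset T} => \sum_(t <- G) a t) s.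

Lemma has_sumP a s : has_sum a s <-> forall e, 0 < e ->
  exists F : {fset T}, forall G, (F `<=` G)%fset -> `|s - \sum_(t <- G) a t| <= e.
Proof.
rewrite /has_sum tendsP; split=> H e /H.
  by move=> [F _ HF]; exists F => G /HF.
by move=> [F HF]; exists F => // G /HF.
Qed.

Lemma has_sum_unique a s s' : has_sum a s -> has_sum a s' -> s = s'.
Proof. exact: tends_unique. Qed.

Lemma has_sumD a b s s' : has_sum a s -> has_sum b s' -> has_sum (fun t => a t + b t) (s + s').
Proof.
move=> A B; rewrite /has_sum; under eq_fun do rewrite big_split /=.
exact: tendsD.
Qed.

Lemma has_sumZ c a s : has_sum a s -> has_sum (fun t => c * a t) (c * s).
Proof.
move=> A; rewrite /has_sum; under eq_fun do rewrite -mulr_sumr.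
by apply: tendsM => //; exact: tends_cst.
Qed.

Lemma has_sumB a b s s' : has_sum a s -> has_sum b s' -> has_sum (fun t => a t - b t) (s - s').
Proof.
move=> A B; rewrite /has_sum; under eq_fun do rewrite sumrB.
exact: tendsB.
Qed.

Lemma has_sum_sum (I : Type) (r : seq I) (a : I -> T -> K) (s : I -> K) :
  (forall i, has_sum (a i) (s i)) ->
  has_sum (fun t => \sum_(i <- r) a i t) (\sum_(i <- r) s i).
Proof.
move=> A; rewrite /has_sum; under eq_fun do rewrite exchange_big /=.
exact: tends_sum.
Qed.

Lemma has_sum1 a t0 : (forall t, t != t0 -> a t = 0) -> has_sum a (a t0).
Proof.
move=> A; apply/has_sumP => e e0; exists [fset t0]%fset => G sG.
have tG : t0 \in G by apply: (fsubsetP sG); rewrite inE.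
rewrite (big_fsetD1 t0) //= big1_seq ?addr0 ?subrr ?normr0 ?ltW// => t /=.
by rewrite !inE => /andP[/A].
Qed.

Lemma big_fset_sub (a : T -> K) (F G : {fset T}) : (F `<=` G)%fset ->
  \sum_(t <- G) a t = \sum_(t <- F) a t + \sum_(t <- (G `\` F)%fset) a t.
Proof.
move=> sFG; rewrite (big_fsetID _ (mem F)) /=; congr (_ + _).
  by apply: eq_fbigl => t; rewrite !inE /=; case: (boolP (t \in F)) => [/(fsubsetP sFG)->|]; rewrite ?andbF.
by apply: eq_fbigl => t; rewrite !inE /= andbC.
Qed.

(** For finite [G] containing [F], both differences of partial sums run over [G] minus [F] and
    compare term by term; then [G] grows. *)
Lemma has_sum_tail a b s B : (forall t, `|a t| <= b t) -> has_sum a s -> has_sum b B ->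
  forall F : {fset T}, `|s - \sum_(t <- F) a t| <= B - \sum_(t <- F) b t.
Proof.
move=> ab A HB F.
apply: (tends_norm_le (F := totally)); last 2 first.
- by apply: tendsB A (tends_cst _).
- by apply: tendsB HB (tends_cst _).
exists F => // G /= sFG; rewrite !(big_fset_sub _ _ _ sFG) [X in `|X|]addrAC [leRHS]addrAC !subrr !add0r.
exact: le_trans (ler_norm_sum _ _ _) (ler_sum _ _).
Qed.

Lemma has_sum_norm_le a b s B :
  (forall t, `|a t| <= b t) -> has_sum a s -> has_sum b B -> `|s| <= B.
Proof.
by move=> ab A HB; have := has_sum_tail _ _ _ _ ab A HB fset0; rewrite !big_seq_fset0 !subr0.
Qed.

Lemma le_has_sum b B : (forall t, 0 <= b t) -> has_sum b B ->
  forall F : {fset T}, \sum_(t <- F) b t <= B.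
Proof.
move=> b0 HB F; rewrite -subr_ge0.
apply: le_trans (has_sum_tail b b B B _ HB HB F) => // t.
by rewrite ger0_norm.
Qed.

(** Converse of [has_sum_tail]: the tails of the majorant tend to zero, so finite tail estimates
    alone identify the sum. *)
Lemma has_sum_of_tail a b s B : has_sum b B ->
  (forall F : {fset T}, `|s - \sum_(t <- F) a t| <= B - \sum_(t <- F) b t) -> has_sum a s.
Proof.
move=> /has_sumP HB H; apply/has_sumP => e /HB [F HF]; exists F => G /HF HG.
apply: (le_trans (H G)); rewrite -[leLHS]ger0_norm //.
exact: le_trans (H G).
Qed.

(* The tail estimate has_sum_tail only involves finite sums and the fixed
   majorant, so it survives pointwise limits. *)
Lemma has_sum_dominated_lim {X : Type} (U : set_system X) {UF : ProperFilter U}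
    (a_ : X -> T -> K) (s_ : X -> K) a b s B :
  U [set x | (forall t, `|a_ x t| <= b t) /\ has_sum (a_ x) (s_ x)] ->
  (forall t, tends U (a_^~ t) (a t)) -> tends U s_ s -> has_sum b B -> has_sum a s.
Proof.
move=> HU Ha Hs HB; apply: (has_sum_of_tail _ _ _ _ HB) => F.
apply: (tends_norm_le (F := U) (fun x => s_ x - \sum_(t <- F) a_ x t)
  (fun=> B - \sum_(t <- F) b t)).
- by apply: filterS HU => x /= [ab A]; apply: has_sum_tail.
- by apply: tendsB => //; exact: tends_sum.
- exact: tends_cst.
Qed.

End UnconditionalSums.

(** A Fubini theorem with a product majorant. Over a finite [F], the error is the sum over [u] of
    the column tails, each at most [(P - \sum_(t <- F) p t) * q u]; the total is [Q] times the tail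
    of [p]. *)
Lemma has_sum_exchange {K : numFieldType} {T S : choiceType} (a : T -> S -> K)
    (p : T -> K) (q : S -> K) (P Q : K) (r : T -> K) (c : S -> K) (s : K) :
  (forall t u, `|a t u| <= p t * q u) -> has_sum p P -> has_sum q Q ->
  (forall t, has_sum (a t) (r t)) -> (forall u, has_sum (a^~ u) (c u)) ->
  has_sum c s -> has_sum r s.
Proof.
move=> apq HP HQ Hr Hc Hs.
apply: (has_sum_of_tail _ (fun t => Q * p t) _ (Q * P)); first exact: has_sumZ.
move=> F; rewrite -mulr_sumr -mulrBr [Q * _]mulrC.
apply: (has_sum_norm_le (fun u => c u - \sum_(t <- F) a t u)
         (fun u => (P - \sum_(t <- F) p t) * q u)).
- move=> u; rewrite mulrBl mulr_suml.
  apply: (has_sum_tail _ (fun t => p t * q u)) => //.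
  by under eq_fun do rewrite mulrC; rewrite mulrC; exact: has_sumZ.
- by apply: has_sumB => //; exact: has_sum_sum.
- exact: has_sumZ.
Qed.

(** * Real sums and their link with [esum] *)

Section RealSums.
Context {R : realType} {T : choiceType}.
Implicit Types (a b : T -> R) (s : R).

Lemma fsum_EFin a (A : set T) : finite_set A ->
  (\sum_(t \in A) (a t)%:E)%E = (\sum_(t <- fset_set A) a t)%:E.
Proof. by move=> fA; rewrite fsbig_finite // sumEFin. Qed.

Lemma fset_le_esum a (F : {fset T}) :
  ((\sum_(t <- F) a t)%:E <= esum setT (fun t => (a t)%:E))%E.
Proof.
apply: ereal_sup_ubound; exists [set` F]; first by split=> //; exact: finite_fset.
by rewrite fsum_EFin ?set_fsetK //; exact: finite_fset.
Qed.

Lemma esum_has_sum a : (forall t, 0 <= a t) ->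
  (esum setT (fun t => (a t)%:E) < +oo)%E ->
  has_sum a (fine (esum setT (fun t => (a t)%:E))).
Proof.
move=> a0 foo; set S := esum _ _.
have S0 : (0 <= S)%E by apply: esum_ge0 => t _; rewrite lee_fin.
have Sfin : S \is a fin_num by rewrite ge0_fin_numE.
apply/has_sumP => e e0.
have [_ [A [fA _] <-]] := ub_ereal_sup_adherent e0 Sfin.
rewrite fsum_EFin // => ltA.
have lt : fine S - e < \sum_(t <- fset_set A) a t by rewrite -lte_fin EFinB fineK.
exists (fset_set A) => G sAG.
have le1 : \sum_(t <- G) a t <= fine S.
  by rewrite -lee_fin fineK //; exact: fset_le_esum.
rewrite ger0_norm ?subr_ge0 // lerBlDr -lerBlDl; apply: (le_trans (ltW lt)).
by rewrite (big_fset_sub _ _ _ sAG) lerDl sumr_ge0.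
Qed.

Lemma has_sum_bounded a M : (forall t, 0 <= a t) ->
  (forall F : {fset T}, \sum_(t <- F) a t <= M) ->
  (esum setT (fun t => (a t)%:E) < +oo)%E.
Proof.
move=> a0 H; apply: (@le_lt_trans _ _ M%:E); last exact: ltry.
apply: ge_ereal_sup => _ [A [fA _] <-].
by rewrite fsum_EFin // lee_fin.
Qed.

Lemma has_sum_esum a s : (forall t, 0 <= a t) -> has_sum a s ->
  esum setT (fun t => (a t)%:E) = s%:E.
Proof.
move=> a0 As; have oo := has_sum_bounded _ _ a0 (le_has_sum _ _ a0 As).
rewrite (has_sum_unique _ _ _ As (esum_has_sum _ a0 oo)) fineK //.
by rewrite ge0_fin_numE //; apply: esum_ge0 => t _; rewrite lee_fin.
Qed.

(** Positive and negative parts are summed separately. The value is written exactly as in [rsum],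
    which ties [has_sum] to [inner]. *)
Lemma dominated_has_sum a b B : (forall t, `|a t| <= b t) -> has_sum b B ->
  has_sum a (fine (esum setT (fun t => (Num.max (a t) 0)%:E))
             - fine (esum setT (fun t => (Num.max (- a t) 0)%:E))).
Proof.
move=> ab HB; have b0 t : 0 <= b t by exact: le_trans (ab t).
have dom c : (forall t, 0 <= c t <= b t) -> has_sum c (fine (esum setT (fun t => (c t)%:E))).
  move=> cb; apply: esum_has_sum => [t|]; first by case/andP: (cb t).
  apply: (has_sum_bounded _ B) => [t|F]; first by case/andP: (cb t).
  apply: le_trans (le_has_sum _ _ b0 HB F).
  by apply: ler_sum => t _; case/andP: (cb t).
rewrite [a in has_sum a](_ : a = (fun t => Num.max (a t) 0 - Num.max (- a t) 0)); last first.
  by apply/funext => t; rewrite /Order.max; case: ltP => ?; case: ltP => ?; lra.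
apply: has_sumB; apply: dom => t; rewrite le_max lexx orbT ge_max b0 andbT /=.
  exact: le_trans (ler_norm _) (ab t).
by apply: le_trans (ab t); rewrite -normrN ler_norm.
Qed.

End RealSums.

(** * Complex sums, inner products and ultrafilter limits *)

Section ComplexSums.
Context {R : realType}.

Lemma norm_normc (z : R[i]) : `|z| = (Normc.normc z)%:C%C.
Proof. by []. Qed.

Lemma normc_sqr (z : R[i]) : (Normc.normc z ^+ 2)%:C%C = z * conjc z.
Proof. by rewrite rmorphXn /= -norm_normc sqr_normc. Qed.

Lemma tends_realC {X : Type} {F : set_system X} {FF : Filter F} (h : X -> R) l :
  tends F h l -> tends F (fun x => (h x)%:C%C) l%:C%C.
Proof.
(* A positive element of [R[i]] has zero imaginary part, so [e] is a real tolerance. *)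
move/tendsP => H; apply/tendsP => e; rewrite ltcE => /andP[/eqP e2 e1].
apply: filterS (H _ e1) => x /= le.
have -> : e = (complex.Re e)%:C%C by rewrite {1}(complexE e) e2 /= mulr0 addr0.
by rewrite -rmorphB /= normc_def /= expr0n /= addr0 sqrtr_sqr lecR.
Qed.

Lemma tends_conj {X : Type} {F : set_system X} {FF : Filter F} (h : X -> R[i]) l :
  tends F h l -> tends F (fun x => conjc (h x)) (conjc l).
Proof.
move/tendsP => H; apply/tendsP => e e0.
by apply: filterS (H _ e0) => x /=; rewrite -rmorphB normcJ.
Qed.

Lemma tends_complex {X : Type} {F : set_system X} {FF : Filter F} (h : X -> R[i]) x y :
  tends F (fun t => complex.Re (h t)) x -> tends F (fun t => complex.Im (h t)) y ->
  tends F h (Complex x y).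
Proof.
move=> hx hy; rewrite (complexE (Complex x y)) /=.
rewrite (_ : h = fun t => (complex.Re (h t))%:C%C + 'i%C * (complex.Im (h t))%:C%C); last first.
  by apply/funext => t; exact: complexE.
apply: tendsD; first exact: tends_realC.
by apply: tendsM (tends_cst _) _; exact: tends_realC.
Qed.

Lemma has_sum_realC {T : choiceType} (a : T -> R) s :
  has_sum a s -> has_sum (fun t => (a t)%:C%C) s%:C%C.
Proof.
by move=> H; rewrite /has_sum; under eq_fun do rewrite -rmorph_sum; exact: tends_realC.
Qed.

Lemma norm_ReIm (z : R[i]) :
  `|complex.Re z| <= Normc.normc z /\ `|complex.Im z| <= Normc.normc z.
Proof.
case: z => x y /=; rewrite -!sqrtr_sqr.
by split; rewrite ler_wsqrtr // ?lerDl ?lerDr sqr_ge0.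
Qed.

(** On [Zg g] this unfolds to [csum]; other index types are allowed because frame labels are summed
    over as well. *)
Definition complex_sum {T : choiceType} (a : T -> R[i]) : R[i] :=
  let rs (r : T -> R) := fine (esum setT (fun t => (Num.max (r t) 0)%:E))
             - fine (esum setT (fun t => (Num.max (- r t) 0)%:E)) in
  Complex (rs (fun t => complex.Re (a t))) (rs (fun t => complex.Im (a t))).

Lemma complex_has_sum {T : choiceType} (a : T -> R[i]) (b : T -> R) B :
  (forall t, Normc.normc (a t) <= b t) -> has_sum b B -> has_sum a (complex_sum a).
Proof.
move=> ab HB; apply: tends_complex.
  under eq_fun do rewrite (raddf_sum (@complex.Re R : Rcomplex R -> R)).
  apply: dominated_has_sum HB => t; exact: le_trans (norm_ReIm _).1 (ab t).
under eq_fun do rewrite (raddf_sum (@complex.Im R : Rcomplex R -> R)).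
apply: dominated_has_sum HB => t; exact: le_trans (norm_ReIm _).2 (ab t).
Qed.

Section Inner.
Context {g : nat}.
Implicit Types u v : Zg g -> R[i].

Lemma is_l2_has_sum u : is_l2 u -> exists B, has_sum (fun m => Normc.normc (u m) ^+ 2) B.
Proof. by move=> h; eexists; apply: esum_has_sum => // t; exact: sqr_ge0. Qed.

Lemma has_sum_is_l2 u B : has_sum (fun m => Normc.normc (u m) ^+ 2) B -> is_l2 u.
Proof. by move=> h; rewrite /is_l2 (has_sum_esum _ B) ?ltry // => t; exact: sqr_ge0. Qed.

(** The product is dominated by the sum of the two squared moduli. *)
Lemma inner_has_sum u v : is_l2 u -> is_l2 v -> has_sum (fun m => u m * conjc (v m)) (inner u v).
Proof.
move=> /is_l2_has_sum [A HA] /is_l2_has_sum[B HB].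
apply: complex_has_sum (has_sumD _ _ _ _ HA HB) => m.
rewrite Normc.normcM.
have -> : Normc.normc (conjc (v m)) = Normc.normc (v m).
  by case: (v m) => x y /=; rewrite sqrrN.
have n0 w : 0 <= Normc.normc (w : R[i]) by case: w => x y /=; rewrite sqrtr_ge0.
have := n0 (u m); have := n0 (v m).
move: (Normc.normc _) (Normc.normc _) => x y; nra.
Qed.

End Inner.

(** As [U] is ultra, an ultrafilter finer than the image filter is contained in it; it converges
    because it lives on the compact segment from [- c] to [c]. *)
Lemma ultra_image_cvg {X : Type} (U : set_system X) {UU : UltraFilter U} (h : X -> R) c :
  U [set x | `|h x| <= c] -> exists l, tends U h l.
Proof.
move=> Hc.
have [G [UG sG]] := ultraFilterLemma (fmap_proper_filter h _ : ProperFilter (h @ U)).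
have sG' : G `<=` h @ U.
  move=> B GB; have [//|H] := in_ultra_setVsetC (h @^-1` B) UU.
  have : G (~` B) by apply: sG.
  move=> /(filterI GB); rewrite setICr => /filter_not_empty [].
have := @segment_compact R (- c) c; rewrite compact_ultra /= => /(_ G UG).
case.
  by apply: sG; rewrite /=; apply: filterS Hc => x /=; rewrite in_itv /= ler_norml.
move=> l [_ Gl]; exists l; rewrite /tends => B /Gl; exact: sG'.
Qed.

Lemma ultra_tends {X : Type} (U : set_system X) {UU : UltraFilter U} (h : X -> R[i]) (c : R) :
  U [set x | Normc.normc (h x) <= c] -> exists l, tends U h l.
Proof.
move=> H.
have [|x Hx] := @ultra_image_cvg X U _ (fun t => complex.Re (h t)) c.
  by apply: filterS H => x /=; apply: le_trans; apply: (norm_ReIm _).1.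
have [|y Hy] := @ultra_image_cvg X U _ (fun t => complex.Im (h t)) c.
  by apply: filterS H => z /=; apply: le_trans; apply: (norm_ReIm _).2.
by exists (Complex x y); apply: tends_complex.
Qed.

End ComplexSums.

Lemma has_sum_reindex {K : numFieldType} {T : choiceType} (tau tau' : T -> T) (a : T -> K) s :
  cancel tau tau' -> cancel tau' tau -> has_sum a s -> has_sum (a \o tau) s.
Proof.
move=> tk tk' /has_sumP H; apply/has_sumP => e /H [F HF].
exists (tau' @` F)%fset => G sG.
have := HF (tau @` G)%fset; rewrite big_imfset /=; last by move=> x y _ _; exact: (can_inj tk).
apply; apply/fsubsetP => x xF; apply/imfsetP; exists (tau' x) => //=.
by apply: (fsubsetP sG); apply/imfsetP; exists x.
Qed.

(** * Summability of exponential decay on the lattice *)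

Section Exponential.
Context {R : realType}.

Lemma geometric_le (r : R) N : 0 <= r < 1 -> \sum_(i < N) r ^+ i <= (1 - r)^-1.
Proof.
move=> /andP[r0 r1]; rewrite -[leRHS]mul1r ler_pdivlMr ?subr_gt0 //.
have -> : (\sum_(i < N) r ^+ i) * (1 - r) = 1 - r ^+ N.
  elim: N => [|N IH]; first by rewrite big_ord0 mul0r expr0 subrr.
  by rewrite big_ord_recr /= mulrDl IH exprS; ring.
by rewrite lerBlDr lerDl exprn_ge0.
Qed.

Lemma le_sum_subset {I : eqType} (r s : seq I) (f : I -> R) :
  uniq r -> {subset r <= s} -> (forall i, 0 <= f i) ->
  \sum_(i <- r) f i <= \sum_(i <- s) f i.
Proof.
move=> ur rs f0; elim: r s ur rs => [|x r IH] s /=.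
  by rewrite big_nil sumr_ge0.
move=> /andP[xr ur] rs; have xs : x \in s by apply: rs; rewrite inE eqxx.
rewrite big_cons (perm_big _ (perm_to_rem xs)) big_cons lerD2l IH // => y yr.
have yx : y != x by apply: contraNneq xr => <-.
have : y \in s by apply: rs; rewrite inE yr orbT.
by rewrite (perm_mem (perm_to_rem xs)) inE (negPf yx).
Qed.

Lemma le_has_sum_seq {T : choiceType} (b : T -> R) B (s : seq T) :
  (forall t, 0 <= b t) -> has_sum b B -> uniq s -> \sum_(t <- s) b t <= B.
Proof.
move=> b0 HB us; apply: le_trans (le_has_sum b B b0 HB [fset t in s]%fset).
by apply: le_sum_subset => // x xs; rewrite !inE.
Qed.

(** A finite set of pairs lies in the product of its first projections with all [N] labels, so its
    sum is at most [B *+ N]. *)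
Lemma has_sum_fst {T : choiceType} (b : T -> R) B N :
  (forall t, 0 <= b t) -> has_sum b B ->
  exists B', has_sum (fun l : T * 'I_N => b l.1) B'.
Proof.
move=> b0 HB; eexists; apply: esum_has_sum => [[t i]//|].
apply: (has_sum_bounded _ (B *+ N)) => [[t i]//|F].
apply: (@le_trans _ _ (\sum_(l <- [seq (t, i) | t <- undup (map fst F), i <- enum 'I_N]) b l.1)).
  apply: le_sum_subset => // -[t i] lF; apply/allpairsP; exists (t, i).
  by rewrite /= mem_enum mem_undup; split=> //; apply/mapP; exists (t, i).
rewrite big_allpairs_dep /=.
under eq_bigr do rewrite big_enum sumr_const card_ord.
by rewrite sumrMnl lerMn2r orbC le_has_sum_seq // undup_uniq.
Qed.

Lemma geometric_seq_le (r : R) (s : seq nat) : 0 <= r < 1 -> uniq s ->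
  \sum_(i <- s) r ^+ i <= (1 - r)^-1.
Proof.
move=> r01 us; have r0 : 0 <= r by case/andP: r01.
apply: le_trans (geometric_le r (\max_(i <- s) i).+1 r01).
rewrite -(big_mkord xpredT (fun i => r ^+ i)).
apply: le_sum_subset => // [i si|i]; last exact: exprn_ge0.
by rewrite mem_index_iota /= ltnS (big_rem i si) /= leq_maxl.
Qed.

Lemma geometric_int_le (r : R) (s : seq int) : 0 <= r < 1 -> uniq s ->
  \sum_(k <- s) r ^+ absz k <= (1 - r)^-1 + (1 - r)^-1.
Proof.
move=> r01 us; rewrite (bigID (fun k => 0 <= k)) /=.
have part (P : pred int) : (forall k l, P k -> P l -> absz k = absz l -> k = l) ->
    \sum_(k <- s | P k) r ^+ absz k <= (1 - r)^-1.
  move=> Pinj; rewrite -big_filter -(big_map absz xpredT (fun i => r ^+ i)).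
  apply: geometric_seq_le => //; rewrite map_inj_in_uniq ?filter_uniq //.
  by move=> k l; rewrite !mem_filter => /andP[Pk _] /andP[Pl _]; exact: Pinj.
by apply: lerD; apply: part => -[k|k] [l|l] //=; [move=> _ _ -> | move=> _ _ [->]].
Qed.

Section Lattice.
Context {g : nat}.
Implicit Types n m : Zg g.

Definition decay (alpha : R) n : R := expR (- alpha * (l1norm n)%:~R).

Lemma decay_ge0 alpha n : 0 <= decay alpha n. Proof. exact: expR_ge0. Qed.

Lemma l1normN n : l1norm (- n) = l1norm n.
Proof. by apply: eq_bigr => i _; rewrite ffunE abszN. Qed.

Lemma l1norm_triangle n m : l1norm (n + m) <= l1norm n + l1norm m.
Proof.
rewrite -big_split /=; apply: ler_sum => i _; rewrite ffunE !abszE.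
exact: ler_normD.
Qed.

Lemma l1norm_ge0 n : 0 <= l1norm n.
Proof. exact: sumr_ge0. Qed.

Lemma decayN alpha n : decay alpha (- n) = decay alpha n.
Proof. by rewrite /decay l1normN. Qed.

Lemma decayC alpha n m : decay alpha (n - m) = decay alpha (m - n).
Proof. by rewrite -decayN opprB. Qed.

Lemma decay_le1 alpha n : 0 <= alpha -> decay alpha n <= 1.
Proof.
move=> a0; rewrite -[leRHS]expR0 ler_expR mulNr oppr_le0 mulr_ge0 // ler0z.
exact: l1norm_ge0.
Qed.

Lemma decayE alpha n : decay alpha n = \prod_(i < g) expR (- alpha) ^+ absz (n i).
Proof.
rewrite /decay /l1norm rmorph_sum mulr_sumr expR_sum; apply: eq_bigr => i _.
by rewrite mulrC -expRM_natl.
Qed.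

(** The l1 norm makes [decay] a product over coordinates, so its sum over a box is a power of a
    two-sided geometric sum. *)
Lemma has_sum_decay alpha : 0 < alpha -> exists B, has_sum (decay alpha) B.
Proof.
move=> a0; eexists; apply: esum_has_sum => [n|]; first exact: decay_ge0.
pose r := expR (- alpha).
have r01 : 0 <= r < 1 by rewrite expR_ge0 expR_lt1 oppr_lt0.
apply: (has_sum_bounded _ (((1 - r)^-1 + (1 - r)^-1) ^+ g)) => [n|F]; first exact: decay_ge0.
(* [s] collects every coordinate occurring in [F], so [F] lies in the box of functions into
   [seq_sub s], a type that also removes repetitions. *)
pose s := [seq n i | n <- enum_fset F, i <- enum 'I_g].
pose v (f : {ffun 'I_g -> seq_sub s}) : Zg g := [ffun i => val (f i)].
apply: (@le_trans _ _ (\sum_(n <- [seq v f | f <- enum {ffun 'I_g -> seq_sub s}]) decay alpha n)).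
  apply: le_sum_subset => // [n nF|n]; last exact: decay_ge0.
  have ns i : n i \in s by apply/allpairsP; exists (n, i); rewrite /= mem_enum.
  apply/mapP; exists [ffun i => SeqSub (ns i)]; first by rewrite mem_enum.
  by apply/ffunP => i; rewrite !ffunE.
rewrite big_map big_enum /=.
under eq_bigr do (rewrite decayE; under eq_bigr do rewrite ffunE).
rewrite -(bigA_distr_bigA (fun _ j => r ^+ absz (val (j : seq_sub s)))) /=.
set S := \sum_(j : seq_sub s) _.
have S0 : 0 <= S by apply: sumr_ge0 => j _; rewrite exprn_ge0 // expR_ge0.
have leS : S <= (1 - r)^-1 + (1 - r)^-1.
  rewrite /S -big_enum -(big_map val xpredT (fun k : int => r ^+ absz k)).
  by rewrite geometric_int_le // map_inj_uniq ?enum_uniq //; exact: val_inj.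
by rewrite prodr_const card_ord lerXn2r // nnegrE // (le_trans S0).
Qed.

Lemma has_sum_decay_centre alpha : 0 < alpha ->
  exists B, forall c, has_sum (fun n => decay alpha (n - c)) B.
Proof.
move=> /has_sum_decay [B HB]; exists B => c.
by apply: (has_sum_reindex (fun n => n - c) (fun n => n + c)) HB => n; rewrite ?subrK ?addrK.
Qed.

End Lattice.
End Exponential.

(** * Localized orthonormal families and the multiplicity of centres *)

Section Localization.
Context {R : realType} {g : nat}.
Implicit Types (u v : Zg g -> R[i]) (n m : Zg g) (H : (Zg g -> R[i]) -> (Zg g -> R[i])).

Lemma normc_ge0 (z : R[i]) : 0 <= Normc.normc z.
Proof. by case: z => x y /=; rewrite sqrtr_ge0. Qed.

Lemma normc_conj (z : R[i]) : Normc.normc (conjc z) = Normc.normc z.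
Proof. by case: z => x y /=; rewrite sqrrN. Qed.

Lemma decay_gt0 (alpha : R) n : 0 < decay alpha n. Proof. exact: expR_gt0. Qed.

(** Triangle inequality with half of the rate: one factor remains summable over the centres [c], the
    other gives off-diagonal decay in [m - n]. *)
Lemma decay_split (alpha : R) n m c : 0 <= alpha ->
  decay alpha (n - c) * decay alpha (m - c) <= decay (alpha / 2) (n - c) * decay (alpha / 2) (m - n).
Proof.
move=> a0; rewrite /decay -!expRD ler_expR.
have : (l1norm (m - n))%:~R <= (l1norm (m - c))%:~R + (l1norm (n - c))%:~R :> R.
  rewrite -intrD ler_int -(l1normN (n - c)).
  have -> : m - n = (m - c) + - (n - c) by rewrite opprB addrA subrK.
  exact: l1norm_triangle.
have : 0 <= (l1norm (m - c))%:~R :> R by rewrite ler0z l1norm_ge0.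
have : 0 <= (l1norm (n - c))%:~R :> R by rewrite ler0z l1norm_ge0.
by move: (_%:~R) (_%:~R) (_%:~R) => x y z; nra.
Qed.

Lemma decay_l2 (beta D : R) c u : 0 < beta ->
  (forall m, Normc.normc (u m) <= D * decay beta (m - c)) -> is_l2 u.
Proof.
move=> b0 Hu; have [B HB] := has_sum_decay_centre (g := g) beta b0.
suff Hd m : `|Normc.normc (u m) ^+ 2| <= D ^+ 2 * decay beta (m - c).
  exact: has_sum_is_l2 _ _ (dominated_has_sum _ _ _ Hd (has_sumZ _ _ _ (HB c))).
rewrite ger0_norm ?sqr_ge0 //.
have := Hu m; have := normc_ge0 (u m); have := decay_gt0 beta (m - c).
have := decay_le1 beta (m - c) (ltW b0).
move: (Normc.normc _) (decay _ _) => x y y1 y0 x0 xy.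
apply: (@le_trans _ _ ((D * y) ^+ 2)); first by rewrite lerXn2r ?nnegrE ?(le_trans x0).
by rewrite exprMn ler_wpM2l ?sqr_ge0 // expr2 ler_piMl // ltW.
Qed.

Lemma l2_bounded u : is_l2 u -> exists M, forall m, Normc.normc (u m) <= M.
Proof.
(* For [x >= 0], [x ^+ 2 <= B] gives [x <= B + 1], without a square root. *)
move=> /is_l2_has_sum [B HB]; exists (B + 1) => m.
have := le_has_sum_seq _ _ [:: m] (fun t => sqr_ge0 _) HB erefl.
by rewrite big_seq1; have := normc_ge0 (u m); move: (Normc.normc _) => x; nra.
Qed.

Lemma l2_norm1_sum u : is_l2 u -> inner u u = 1 -> has_sum (fun m => Normc.normc (u m) ^+ 2) 1.
Proof.
move=> lu u1; have [B HB] := is_l2_has_sum u lu.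
have := inner_has_sum u u lu lu; rewrite u1.
under eq_fun do rewrite -normc_sqr.
by move=> /(has_sum_unique _ _ _ (has_sum_realC _ _ HB)) [<-].
Qed.

(** Bessel's inequality for the delta function at [n]. Its projection [v] onto the span has squared
    norm [x] and satisfies [v n = x]; hence [x ^+ 2 <= x]. *)
Lemma bessel_delta (phi : nat -> Zg g -> R[i]) n (s : seq nat) :
  (forall k, is_l2 (phi k)) ->
  (forall k l, inner (phi k) (phi l) = (if k == l then 1 else 0)) ->
  uniq s -> \sum_(k <- s) Normc.normc (phi k n) ^+ 2 <= 1.
Proof.
move=> l2 on us; set x := \sum_(k <- s) _.
pose v m := \sum_(k <- s) conjc (phi k n) * phi k m.
have vn : v n = x%:C%C.
  by rewrite rmorph_sum; apply: eq_bigr => k _ /=; rewrite normc_sqr mulrC.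
have Hv : has_sum (fun m => v m * conjc (v m)) x%:C%C.
  have -> : x%:C%C = \sum_(k <- s) \sum_(l <- s) conjc (phi k n) * phi l n * (if k == l then 1 else 0).
    rewrite rmorph_sum; apply: eq_big_seq => k ks /=.
    rewrite (bigD1_seq k) //= eqxx mulr1 big1 ?addr0 ?normc_sqr 1?mulrC // => l lk.
    by rewrite eq_sym (negPf lk) mulr0.
  rewrite [X in has_sum X](_ : _ = fun m => \sum_(k <- s) \sum_(l <- s)
      conjc (phi k n) * phi l n * (phi k m * conjc (phi l m))); last first.
    apply/funext => m; rewrite rmorph_sum mulr_suml; apply: eq_bigr => k _ /=.
    rewrite mulr_sumr; apply: eq_bigr => l _; rewrite rmorphM /= conjcK; ring.
  do 2 (apply: has_sum_sum => ?); apply: has_sumZ; rewrite -on.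
  exact: inner_has_sum.
have := le_has_sum _ _ (fun m => mulcJ_ge0 (v m)) Hv [fset n]%fset.
rewrite big_seq_fset1 vn conjc_real -rmorphM lecR.
have : 0 <= x by apply: sumr_ge0 => k _; exact: sqr_ge0.
by move: x {vn Hv} => x; nra.
Qed.

(** [F] is chosen from [alpha] and [C] alone so that the majorant has mass at most 1/2 outside it.
    Functions centred at [m] thus keep mass 1/2 on [F] translated by [m], and Bessel at each of
    those sites gives [N = 2 * #|F|]. *)
Lemma centre_multiplicity (alpha C : R) : 0 < alpha -> exists N : nat,
  forall (phi : nat -> Zg g -> R[i]) (c : nat -> Zg g),
  complete_orthonormal phi ->
  (forall k m, Normc.normc (phi k m) <= C * decay alpha (m - c k)) ->
  forall m (s : seq nat), uniq s -> {in s, forall k, c k = m} -> (size s <= N)%N.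
Proof.
move=> a0; have [B HB] := has_sum_decay_centre (g := g) alpha a0.
have Hb := has_sumZ (C ^+ 2) _ _ (HB 0).
have half0 : 0 < 2^-1 :> R by rewrite invr_gt0.
have [F HF] := (has_sumP _ _).1 Hb _ half0.
exists (2 * #|` F|)%N => phi c [l2 [on _]] bd m s us sc.
have half k : k \in s -> 2^-1 <= \sum_(n <- F) Normc.normc (phi k (n + m)) ^+ 2.
  move=> ks; have H1 : has_sum (fun n => Normc.normc (phi k (n + m)) ^+ 2) 1.
    have h := l2_norm1_sum _ (l2 k) _.
    apply: (has_sum_reindex (fun n => n + m) (fun n => n - m) _ _ _ _ (h _)) => [n|n|].
    - by rewrite addrK.
    - by rewrite subrK.
    - by rewrite on eqxx.
  have := has_sum_tail _ _ _ _ _ H1 Hb F; have := HF F (fsubset_refl _).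
  move=> h1 h2; have {}h2 := le_trans (h2 _) (le_trans (ler_norm _) h1).
  suff /h2 : forall n, `|Normc.normc (phi k (n + m)) ^+ 2| <= C ^+ 2 * decay alpha (n - 0).
    rewrite ler_norml => /andP[]; lra.
  move=> n.
    rewrite ger0_norm ?sqr_ge0 // subr0.
    have := bd k (n + m); rewrite (sc k ks) addrK.
    have := normc_ge0 (phi k (n + m)); have := decay_gt0 alpha n.
    have := decay_le1 alpha n (ltW a0).
    move: (Normc.normc _) (decay _ _) => x y y1 y0 x0 xy.
    apply: (@le_trans _ _ ((C * y) ^+ 2)); first by rewrite lerXn2r ?nnegrE ?(le_trans x0).
    by rewrite exprMn ler_wpM2l ?sqr_ge0 // expr2 ler_piMl // ltW.
have sum_const (I : Type) (r : seq I) (x : R) : \sum_(i <- r) x = (size r)%:R * x.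
  by rewrite big_const_seq iter_addr_0 count_predT mulr_natl.
have : (size s)%:R * 2^-1 <= (#|` F|)%:R :> R.
  rewrite -sum_const -[leRHS]mulr1 -sum_const big_seq.
  apply: (le_trans (ler_sum _ half)); rewrite -big_seq exchange_big /=.
  by apply: ler_sum => n _; exact: bessel_delta.
by rewrite ler_pdivrMr // mulrC -natrM ler_nat.
Qed.

End Localization.

(* Each index is labelled by its value and by its rank among the earlier
   indices with the same value. *)
Lemma bounded_fibre_label (T : eqType) (c : nat -> T) (N : nat) :
  (forall m (s : seq nat), uniq s -> {in s, forall k, c k = m} -> (size s <= N)%N) ->
  exists lab : nat -> T * 'I_N.+1, injective lab /\ forall k, (lab k).1 = c k.
Proof.
move=> cN; pose rank k := count (fun l => c l == c k) (iota 0 k).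
have rankN k : (rank k < N.+1)%N.
  rewrite ltnS /rank -size_filter; apply: (cN (c k)); first by rewrite filter_uniq ?iota_uniq.
  by move=> l; rewrite mem_filter => /andP[/eqP].
have rank_lt k l : (k < l)%N -> c k = c l -> (rank k < rank l)%N.
  move=> kl ckl.
  have E : iota 0 l = iota 0 k ++ k :: iota k.+1 (l - k.+1).
    by rewrite -[l in LHS](subnKC kl) addSnnS iotaD.
  by rewrite /rank E count_cat /= ckl eqxx addnCA add1n ltnS leq_addr.
exists (fun k => (c k, Ordinal (rankN k))); split=> // k l [ckl rkl].
apply/eqP; case: (ltngtP k l) => // kl.
  by have := rank_lt _ _ kl ckl; rewrite rkl ltnn.
by have := rank_lt _ _ kl (esym ckl); rewrite rkl ltnn.
Qed.

(** * From a localized eigenbasis to a frame with a fixed index set *)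

Section LocalizedFrame.
Context {R : realType} {g : nat}.
Implicit Types (u v : Zg g -> R[i]) (n m : Zg g) (H : (Zg g -> R[i]) -> (Zg g -> R[i])).

(* An orthonormal eigenbasis padded with zero vectors, so that it is indexed by
   a set independent of the operator.  The eigenvalue equation is written
   without the eigenvalue, which makes every clause stable under pointwise
   limits even when the potential is unbounded. *)
Definition localized_frame H (alpha C : R) (N : nat) (psi : Zg g * 'I_N -> Zg g -> R[i]) : Prop :=
  [/\ forall l n, Normc.normc (psi l n) <= C * decay alpha (n - l.1),
      forall l l', l != l' -> has_sum (fun m => psi l m * conjc (psi l' m)) 0,
      forall l, has_sum (fun m => psi l m * conjc (psi l m)) 0
                \/ has_sum (fun m => psi l m * conjc (psi l m)) 1,
      forall l n n', H (psi l) n * psi l n' = H (psi l) n' * psi l n &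
      forall n m, has_sum (fun l => psi l n * conjc (psi l m)) (n == m)%:R].

Lemma decay0 (alpha : R) : decay alpha (0 : Zg g) = 1.
Proof.
rewrite /decay /l1norm big1 ?mulr0 ?expR0 // => i _.
by rewrite ffunE.
Qed.

Lemma bound_ge0 (alpha C : R) c u :
  (forall m, Normc.normc (u m) <= C * decay alpha (m - c)) -> 0 <= C.
Proof.
by move=> /(_ c); rewrite subrr decay0 mulr1; apply: le_trans; exact: normc_ge0.
Qed.

(** [N] is chosen before [H], so one index set serves all operators with these constants. *)
Lemma frame_of_ULE (alpha C : R) : 0 < alpha -> exists N : nat, forall H,
  ULE_with H alpha C -> exists psi : Zg g * 'I_N -> Zg g -> R[i], localized_frame H alpha C N psi.
Proof.
move=> a0; have [N HN] := centre_multiplicity (g := g) alpha C a0.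
exists N.+1 => H [phi [c [CO [eig bd]]]].
have [lab [labI labc]] := bounded_fibre_label _ c N (HN phi c CO bd).
have C0 : 0 <= C by exact: bound_ge0 (bd 0).
have [l2 [on compl]] := CO.
pose psi l : Zg g -> R[i] := if pselect (exists k, lab k = l) is left e
  then phi (projT1 (cid e)) else fun=> 0.
have psi_lab k : psi (lab k) = phi k.
  rewrite /psi; case: pselect => [e|[]]; last by exists k.
  by case: (cid e) => k' /= /labI ->.
have psiP l : (exists2 k, lab k = l & psi l = phi k) \/
              ((forall k, lab k <> l) /\ psi l = fun=> 0).
  case: (pselect (exists k, lab k = l)) => [[k <-]|nl].
    by left; exists k => //; exact: psi_lab.
  right; split=> [k kl|]; first by apply: nl; exists k.
  by rewrite /psi; case: pselect.
have bdpsi l n : Normc.normc (psi l n) <= C * decay alpha (n - l.1).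
  case: (psiP l) => [[k <- ->]|[_ ->]]; first by rewrite labc; exact: bd.
  by rewrite Normc.normc0 mulr_ge0 // decay_ge0.
have l2psi l : is_l2 (psi l) by exact: decay_l2 (bdpsi l).
have has_sum0 (a : Zg g -> R[i]) : (forall m, a m = 0) -> has_sum a 0.
  by move=> a0'; rewrite -(a0' 0); apply: has_sum1.
exists psi; split => //.
- move=> l l' ll'; case: (psiP l) => [[k kl ->]|[_ ->]]; last first.
    by apply: has_sum0 => m; rewrite mul0r.
  case: (psiP l') => [[k' kl' ->]|[_ ->]]; last first.
    by apply: has_sum0 => m; rewrite conjc0 mulr0.
  have := on k k'; case: eqP => [kk'|_ <-]; first by rewrite -kl -kl' kk' eqxx in ll'.
  exact: inner_has_sum.
- move=> l; case: (psiP l) => [[k kl ->]|[_ ->]].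
    by right; have := on k k; rewrite eqxx => <-; exact: inner_has_sum.
  by left; apply: has_sum0 => m; rewrite mul0r.
- move=> l n n'; case: (psiP l) => [[k kl ->]|[_ ->]]; last by rewrite !mulr0.
  by have [_ [_ [E HE]]] := eig k; rewrite !HE; ring.
move=> n0 n; have a20 : 0 < alpha / 2 by rewrite divr_gt0.
(* It remains to expand the delta function at [n]. The split bound makes the kernel [K] converge and
   decay away from [n], so the defect [d] is square summable and can be tested against the basis. *)
have [B HB] := has_sum_decay_centre (g := g) _ a20.
have dom m l : Normc.normc (psi l m * conjc (psi l n))
    <= C ^+ 2 * decay (alpha / 2) (m - n) * decay (alpha / 2) (l.1 - n).
  rewrite Normc.normcM normc_conj.
  apply: (@le_trans _ _ ((C * decay alpha (m - l.1)) * (C * decay alpha (n - l.1)))).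
    by apply: ler_pM => //; exact: normc_ge0.
  rewrite mulrACA -expr2 -mulrA; apply: ler_wpM2l; first exact: sqr_ge0.
  by rewrite mulrC [leRHS]mulrC (decayC _ l.1 n); exact/decay_split/ltW.
have [B' HB'] := has_sum_fst (fun m => decay (alpha / 2) (m - n)) B N.+1
   (fun m => decay_ge0 _ _) (HB n).
pose K m := complex_sum (fun l => psi l m * conjc (psi l n)).
have HK m : has_sum (fun l => psi l m * conjc (psi l n)) (K m).
  exact: complex_has_sum (dom m) (has_sumZ _ _ _ HB').
have bdK m : Normc.normc (K m) <= C ^+ 2 * B' * decay (alpha / 2) (m - n).
  rewrite mulrAC -lecR -norm_normc.
  apply: has_sum_norm_le (HK m) (has_sum_realC _ _ (has_sumZ _ _ _ HB')) => l.
  by rewrite norm_normc lecR.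
pose d m := (m == n)%:R - K m.
have l2d : is_l2 d.
  apply: (decay_l2 (alpha / 2) (1 + C ^+ 2 * B') n) => // m.
  apply: le_trans (le_normcD _ _) _; rewrite normcN mulrDl mul1r lerD //.
  case: eqP => [->|_]; first by rewrite subrr decay0 Normc.normc1.
  by rewrite Normc.normc0 decay_ge0.
have : d = fun=> 0.
  apply: compl => // k.
  apply: has_sum_unique (inner_has_sum _ _ l2d (l2 k)) _.
  have -> : (0 : R[i]) = conjc (phi k n) - conjc (phi k n) by rewrite subrr.
  under eq_fun do rewrite mulrBl.
  apply: has_sumB.
    rewrite [X in has_sum _ X](_ : _ = (n == n)%:R * conjc (phi k n)); last by rewrite eqxx mul1r.
    by apply: (has_sum1 (fun m => (m == n)%:R * conjc (phi k m))) => m /negPf ->; rewrite mul0r.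
  (* Summing over sites first leaves, by orthonormality, only the label [lab k]. The factor
     [phi k m] supplies the majorant in [m], and [psi l n] the one in [l]. *)
  pose a m l := psi l m * conjc (psi l n) * conjc (phi k m).
  have [A HA] := has_sum_decay_centre (g := g) _ a0.
  have [A' HA'] := has_sum_fst (fun m => decay alpha (m - n)) A N.+1
    (fun m => decay_ge0 _ _) (HA n).
  apply: (has_sum_exchange a _ _ _ _ _ (fun l => conjc (psi l n) * inner (psi l) (phi k)) _ _
    (has_sum_realC _ _ (has_sumZ C _ _ (has_sumZ C _ _ (HA (c k)))))
    (has_sum_realC _ _ (has_sumZ C _ _ HA'))).
  - move=> m l; rewrite /a norm_normc -rmorphM lecR !Normc.normcM !normc_conj /=.
    rewrite mulrAC; apply: ler_pM; rewrite ?mulr_ge0 ?normc_ge0 //; last first.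
      by rewrite (decayC _ l.1); exact: bdpsi.
    apply: ler_pM; rewrite ?normc_ge0 //.
    apply: le_trans (bdpsi l m) _; rewrite ler_piMr //.
    by apply: decay_le1; exact: ltW.
  - by move=> m; rewrite /a; under eq_fun do rewrite mulrC; rewrite mulrC; exact: has_sumZ.
  - move=> l; rewrite /a; under eq_fun do rewrite (mulrC (psi l _)) -mulrA.
    by apply: has_sumZ; exact: inner_has_sum.
  - have E : conjc (phi k n) = conjc (psi (lab k) n) * inner (psi (lab k)) (phi k).
      by rewrite psi_lab on eqxx mulr1.
    rewrite E; apply: has_sum1 => l llab; case: (psiP l) => [[k' kl ->]|[_ ->]]; last first.
      by rewrite conjc0 mul0r.
    rewrite on; case: eqP => [kk|_]; last by rewrite mulr0.
    by rewrite -kl kk eqxx in llab.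
move=> /(congr1 (@^~ n0)); rewrite /d => /eqP; rewrite subr_eq0 => /eqP ->.
exact: HK.
Qed.

End LocalizedFrame.

(** * From frames back to eigenbases, and limits of frames *)

Lemma has_sum_finite_support {K : numFieldType} {T : choiceType} (a : T -> K) (F : {fset T}) :
  (forall t, t \notin F -> a t = 0) -> has_sum a (\sum_(t <- F) a t).
Proof.
move=> a0; apply/has_sumP => e e0; exists F => G sG.
rewrite (big_fset_sub _ _ _ sG) [X in _ - (_ + X)]big1_seq ?addr0 ?subrr ?normr0 ?ltW // => t /=.
by rewrite !inE => /andP[/a0].
Qed.

Lemma has_sum0 {K : numFieldType} {T : choiceType} : has_sum (fun _ : T => (0 : K)) 0.
Proof.
have := has_sum_finite_support (fun _ : T => (0 : K)) fset0.
by rewrite big_seq_fset0; apply.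
Qed.

Section Frames.
Context {R : realType} {g : nat}.
Implicit Types (u v : Zg g -> R[i]) (n m : Zg g) (H : (Zg g -> R[i]) -> (Zg g -> R[i])).

(** For [g = 0] the lattice is a single point, where two unit vectors already violate Bessel's
    inequality. *)
Lemma ULE_dim_gt0 H (alpha C : R) : ULE_with H alpha C -> (0 < g)%N.
Proof.
move=> [phi [_ [[l2 [on _]] _]]]; case: (posnP g) => // g0.
have eqZ n : n = 0 by apply/ffunP => -[j lt]; exfalso; move: lt; rewrite g0.
have norm1 k : Normc.normc (phi k 0) ^+ 2 = 1.
  have h : inner (phi k) (phi k) = 1 by rewrite on eqxx.
  apply: has_sum_unique (l2_norm1_sum _ (l2 k) h).
  by apply: has_sum1 => t; rewrite (eqZ t) eqxx.
have := bessel_delta phi 0 [:: 0%N; 1%N] l2 on erefl.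
by rewrite big_cons big_seq1 !norm1; lra.
Qed.

Section OneFrame.
Variables (H : (Zg g -> R[i]) -> (Zg g -> R[i])) (alpha C : R) (N : nat).
Variable psi : Zg g * 'I_N -> Zg g -> R[i].
Hypotheses (g0 : (0 < g)%N) (alpha0 : 0 < alpha) (fr : localized_frame H alpha C N psi).

Let bd l n : Normc.normc (psi l n) <= C * decay alpha (n - l.1).
Proof. by case: fr => + _ _ _ _; apply. Qed.

Let L := [set l | has_sum (fun m => psi l m * conjc (psi l m)) 1].

Lemma frame_l2 l : is_l2 (psi l).
Proof. exact: decay_l2 alpha C l.1 (psi l) alpha0 (bd l). Qed.

Lemma frame_inner l l' s : has_sum (fun m => psi l m * conjc (psi l' m)) s ->
  inner (psi l) (psi l') = s.
Proof. by apply: has_sum_unique; apply: inner_has_sum; exact: frame_l2. Qed.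

Lemma frame_off l : ~ L l -> psi l = fun=> 0.
Proof.
move=> nL; case: fr => _ _ /(_ l) [h0|//] _ _; apply/funext => m.
have := le_has_sum _ _ (fun n => mulcJ_ge0 (psi l n)) h0 [fset m]%fset.
rewrite big_seq_fset1 => le0.
have : psi l m * conjc (psi l m) == 0 by rewrite eq_le le0 mulcJ_ge0.
by rewrite mulf_eq0 conjc_eq0 orbb => /eqP.
Qed.

Lemma frame_norm l : L l -> has_sum (fun m => Normc.normc (psi l m) ^+ 2) 1.
Proof. by move=> /frame_inner; apply: l2_norm1_sum; exact: frame_l2. Qed.

(** Trace argument: if [L] had [K] elements, completeness would give total mass [K.+1] on the [K.+1]
    diagonal sites [p j], while each vector carries at most 1. *)
Lemma frame_infinite : infinite_set L.
Proof.
move=> finL; pose F := fset_set L; pose K := #|` F|.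
have LF l : (l \in F) = `[< L l >] by rewrite in_fset_set // inE.
pose p (j : nat) : Zg g := [ffun=> j%:Z].
have pinj : injective p.
  by move=> j k /ffunP /(_ (Ordinal g0)); rewrite !ffunE => -[].
have one n : \sum_(l <- F) Normc.normc (psi l n) ^+ 2 = 1.
  case: fr => _ _ _ _ /(_ n n); rewrite eqxx => comp.
  have : has_sum (fun l => psi l n * conjc (psi l n)) (\sum_(l <- F) psi l n * conjc (psi l n)).
    apply: has_sum_finite_support => l; rewrite LF => /asboolPn /frame_off ->.
    by rewrite mul0r.
  move=> /(has_sum_unique _ _ _ comp) E; apply: complexI.
  by rewrite rmorph_sum rmorph1 [RHS]E; apply: eq_bigr => l _ /=; rewrite normc_sqr.
have : \sum_(j < K.+1) \sum_(l <- F) Normc.normc (psi l (p j)) ^+ 2 <= K%:R.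
  rewrite exchange_big /=.
  apply: (@le_trans _ _ (\sum_(l <- F) 1)); last first.
    by rewrite big_const_seq iter_addr_0 count_predT.
  rewrite big_seq [leRHS]big_seq; apply: ler_sum => l; rewrite LF => /asboolP /frame_norm h.
  rewrite -(big_mkord xpredT (fun j => Normc.normc (psi l (p j)) ^+ 2)).
  rewrite -(big_map p xpredT (fun n => Normc.normc (psi l n) ^+ 2)).
  apply: le_has_sum_seq h _ => [t|]; first exact: sqr_ge0.
  by rewrite map_inj_uniq // iota_uniq.
under eq_bigr do rewrite one.
by rewrite sumr_const card_ord ler_nat ltnn.
Qed.

Lemma frame_complete u : is_l2 u -> (forall l, L l -> inner u (psi l) = 0) -> u = fun=> 0.
Proof.
move=> l2u uL; apply/funext => n; have [M HM] := l2_bounded u l2u.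
have M0 : 0 <= M by apply: le_trans (HM 0); exact: normc_ge0.
have a20 : 0 < alpha / 2 by rewrite divr_gt0.
have [B HB] := has_sum_decay_centre (g := g) _ a20.
have [B' HB'] := has_sum_fst (fun m => decay (alpha / 2) (m - n)) B N
   (fun m => decay_ge0 _ _) (HB n).
have C0 (l : Zg g * 'I_N) : 0 <= C by exact: bound_ge0 (bd l).
suff : has_sum (fun l : Zg g * 'I_N => (0 : R[i])) (u n).
  by move=> /has_sum_unique; apply; exact: has_sum0.
(* Summing over [m] first gives zero for each [l]; summing over [l] first gives the delta function
   times [u], whose sum is [u n]. *)
pose a (l : Zg g * 'I_N) m := psi l n * (u m * conjc (psi l m)).
apply: (has_sum_exchange a _ _ _ _ _ (fun m => (n == m)%:R * u m) _ _
    (has_sum_realC _ _ (has_sumZ (M * C ^+ 2) _ _ HB'))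
    (has_sum_realC _ _ (HB n))).
- move=> l m; rewrite /a norm_normc -rmorphM lecR !Normc.normcM normc_conj.
  apply: (@le_trans _ _ ((C * decay alpha (n - l.1)) * (M * (C * decay alpha (m - l.1))))).
    apply: ler_pM; rewrite ?mulr_ge0 ?normc_ge0 ?bd //.
    by apply: ler_pM; rewrite ?normc_ge0 ?bd.
  rewrite (mulrCA M) mulrACA [X in _ * X]mulrCA mulrA -expr2 (mulrC (C ^+ 2)).
  rewrite -[leRHS]mulrA; apply: ler_wpM2l; first by rewrite mulr_ge0 ?sqr_ge0.
  by rewrite (decayC _ l.1); apply: decay_split; exact: ltW.
- move=> l; rewrite -[X in has_sum _ X](mulr0 (psi l n)); apply: has_sumZ.
  case: (pselect (L l)) => [/uL <-|/frame_off ->].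
    by apply: inner_has_sum => //; exact: frame_l2.
  by under eq_fun do rewrite conjc0 mulr0; exact: has_sum0.
- move=> m; rewrite mulrC /a; under eq_fun do rewrite mulrCA; apply: has_sumZ.
  by case: fr.
- have E : u n = (n == n)%:R * u n by rewrite eqxx mul1r.
  rewrite [X in has_sum _ X]E; apply: (has_sum1 (fun m => (n == m)%:R * u m)) => m.
  by rewrite eq_sym => /negPf ->; rewrite mul0r.
Qed.

(** The zero vectors are discarded: [L] is countable and infinite, so [nat] enumerates it. *)
Lemma ULE_of_frame : ULE_with H alpha C.
Proof.
have cL : (L #= [set: nat])%card.
  by rewrite card_eq_le; apply/andP; split; [exact: countableP | exact/infiniteP/frame_infinite].
have /card_set_bijP [f [_ finj fsurj]] := cL.
pose e k := projT1 (cid2 (fsurj k Logic.I)).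
have eL k : L (e k) by rewrite /e; case: cid2.
have fe k : f (e k) = k by rewrite /e; case: cid2.
have ef l : L l -> e (f l) = l.
  by move=> Ll; apply: finj; [exact: mem_set (eL _)|exact: mem_set|exact: fe].
exists (fun k => psi (e k)); exists (fun k => (e k).1).
split; [|split].
- split; first by move=> k; exact: frame_l2.
  split=> [k k'|u l2u uk].
    apply: frame_inner; case: eqP => [<-|kk']; first exact: eL.
    by case: fr => _ + _ _ _; apply; apply/eqP => /(congr1 f); rewrite !fe.
  by apply: frame_complete => // l Ll; rewrite -(ef l Ll); exact: uk.
- move=> k; split; first exact: frame_l2.
  have nz : psi (e k) <> fun=> 0.
    move=> z; have := eL k; rewrite /L /= z.
    under eq_fun do rewrite mul0r.
    move=> /has_sum_unique - /(_ _ has_sum0).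
    by move/eqP; rewrite oner_eq0.
  split; first exact: nz.
  have [n0 n00] : exists n0, psi (e k) n0 != 0.
    apply: contrapT => h; apply: nz; apply/funext => m; apply: contrapT => /eqP hm.
    by apply: h; exists m.
  (* The cross-multiplied equation at a site where the vector is nonzero recovers the eigenvalue. *)
  exists (H (psi (e k)) n0 / psi (e k) n0) => n.
  case: fr => _ _ _ + _ => /(_ (e k) n n0) E.
  by apply: (mulIf n00); rewrite /= E mulrAC divfK.
- by move=> k m; exact: bd.
Qed.

End OneFrame.

(** [Hop] seen as a function of the potential along the orbit only, so that limits and translations
    act on [V]. *)
Definition schrodinger (V : Zg g -> R) u : Zg g -> R[i] :=
  fun n => (\sum_(i < g) (u (n + unitv i) + u (n - unitv i))) + (V n)%:C%C * u n.

Lemma frame_lim {X : Type} (U : set_system X) {UU : UltraFilter U}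
    (V_ : X -> Zg g -> R) (V : Zg g -> R) (alpha C : R) (N : nat) :
  0 < alpha -> (forall n, tends U (V_^~ n) (V n)) ->
  U [set x | exists psi, localized_frame (schrodinger (V_ x)) alpha C N psi] ->
  exists psi, localized_frame (schrodinger V) alpha C N psi.
Proof.
move=> a0 VV UF.
have [psi_ Hpsi_] : exists psi_ : X -> Zg g * 'I_N -> Zg g -> R[i],
    U [set x | localized_frame (schrodinger (V_ x)) alpha C N (psi_ x)].
  (* The zero default is used only where no frame exists, that is, off a set belonging to [U]. *)
  exists (fun x => if pselect (exists psi, localized_frame (schrodinger (V_ x)) alpha C N psi)
     is left e then projT1 (cid e) else fun _ _ => 0).
  apply: filterS UF => x /= ex; case: pselect => // e; exact: (projT2 (cid e)).
have lim l n : exists z, tends U (fun x => psi_ x l n) z.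
  apply: (ultra_tends _ _ (C * decay alpha (n - l.1))).
  by apply: filterS Hpsi_ => x /= [+ _ _ _ _]; apply.
pose psi l n := projT1 (cid (lim l n)).
have Hpsi l n : tends U (fun x => psi_ x l n) (psi l n) by exact: (projT2 (cid (lim l n))).
(* The operator reads finitely many values, so pointwise convergence suffices. *)
have tH l n : tends U (fun x => schrodinger (V_ x) (psi_ x l) n) (schrodinger V (psi l) n).
  apply: tendsD; first by apply: tends_sum => i; exact: tendsD.
  by apply: tendsM => //; exact: tends_realC.
have bdlim l n : Normc.normc (psi l n) <= C * decay alpha (n - l.1).
  rewrite -lecR -norm_normc; apply: (tends_norm_le (F := U) (fun x => psi_ x l n)
    (fun=> (C * decay alpha (n - l.1))%:C%C)) => //; last exact: tends_cst.
  by apply: filterS Hpsi_ => x /= [+ _ _ _ _] => /(_ l n); rewrite norm_normc lecR.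
have [B HB] := has_sum_decay_centre (g := g) _ a0.
have dom x l l' n m : localized_frame (schrodinger (V_ x)) alpha C N (psi_ x) ->
    `|psi_ x l n * conjc (psi_ x l' m)| <= (C ^+ 2 * decay alpha (n - l.1))%:C%C.
  case=> bd _ _ _ _; rewrite norm_normc lecR Normc.normcM normc_conj.
  have C0 : 0 <= C by exact: bound_ge0 (bd l).
  rewrite expr2 -mulrA [leRHS]mulrC.
  apply: ler_pM; rewrite ?normc_ge0 ?bd //.
  apply: le_trans (bd l' m) _; rewrite ler_piMr //.
  by apply: decay_le1; exact: ltW.
have limsum l l' (s_ : X -> R[i]) s : tends U s_ s ->
    U [set x | has_sum (fun m => psi_ x l m * conjc (psi_ x l' m)) (s_ x)] ->
    has_sum (fun m => psi l m * conjc (psi l' m)) s.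
  move=> ss Hs; apply: (has_sum_dominated_lim U (fun x m => psi_ x l m * conjc (psi_ x l' m)) s_
    _ _ _ _ _ _ ss (has_sum_realC _ _ (has_sumZ (C ^+ 2) _ _ (HB l.1)))).
    by apply: filterS2 Hpsi_ Hs => x /= fx hx; split=> // m; exact: dom.
  by move=> m; apply: tendsM; [exact: Hpsi|exact: tends_conj (Hpsi _ _)].
exists psi; split; first exact: bdlim.
- move=> l l' ll'; apply: (limsum l l' (fun=> 0)); first exact: tends_cst.
  by apply: filterS Hpsi_ => x /= [_ + _ _ _]; apply.
(* The ultrafilter decides whether the squared norm is 0 or 1 on a large set, so no intermediate
   value appears in the limit. *)
- move=> l; have [h|h] := in_ultra_setVsetC
      [set x | has_sum (fun m => psi_ x l m * conjc (psi_ x l m)) 0] UU.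
    by left; apply: (limsum l l (fun=> 0)) => //; exact: tends_cst.
  right; apply: (limsum l l (fun=> 1)); first exact: tends_cst.
  apply: filterS2 Hpsi_ h => x [_ _ hx _ _] nh.
  by case: (hx l) => h0; [case: (nh h0)|exact: h0].
- move=> l n n'.
  pose h x i j := schrodinger (V_ x) (psi_ x l) i * psi_ x l j.
  have th i j : tends U (fun x => h x i j) (schrodinger V (psi l) i * psi l j).
    exact: tendsM.
  apply: (tends_unique _ _ _ (th n n')); apply: tends_near (th n' n).
  by apply: filterS Hpsi_ => x [_ _ _ hx _]; exact: hx.
- move=> n m.
  have [B' HB'] := has_sum_fst (fun m => decay alpha (m - n)) B N
   (fun m => decay_ge0 _ _) (HB n).
  apply: (has_sum_dominated_lim U (fun x l => psi_ x l n * conjc (psi_ x l m))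
    (fun=> (n == m)%:R)
    _ _ _ _ _ _ (tends_cst _) (has_sum_realC _ _ (has_sumZ (C ^+ 2) _ _ HB'))).
    apply: filterS Hpsi_ => x fx; split=> [l|]; last by case: fx.
    by rewrite (decayC _ l.1); exact: dom.
  by move=> l; apply: tendsM; [exact: Hpsi|exact: tends_conj (Hpsi _ _)].
Qed.

End Frames.

(** * Translation of the potential and weakening of the constants *)

Section Translation.
Context {R : realType} {g : nat}.
Implicit Types (u w : Zg g -> R[i]) (n v : Zg g).

Lemma is_l2_shift v u : is_l2 u -> is_l2 (fun n => u (n + v)).
Proof.
move=> /is_l2_has_sum [B HB]; apply: (has_sum_is_l2 _ B).
by apply: (has_sum_reindex (fun n => n + v) (fun n => n - v) _ _ _ _ HB) => n; rewrite ?addrK ?subrK.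
Qed.

Lemma inner_shift v u w : is_l2 u -> is_l2 w ->
  inner (fun n => u (n + v)) (fun n => w (n + v)) = inner u w.
Proof.
move=> lu lw; apply: has_sum_unique (inner_has_sum _ _ _ _) _; [exact: is_l2_shift..|].
apply: (has_sum_reindex (fun n => n + v) (fun n => n - v) _ _ _ _ (inner_has_sum _ _ lu lw)) => n.
  by rewrite addrK.
by rewrite subrK.
Qed.

Lemma ULE_shift v (V : Zg g -> R) (alpha C : R) :
  ULE_with (schrodinger V) alpha C -> ULE_with (schrodinger (fun n => V (n + v))) alpha C.
Proof.
move=> [phi [c [[l2 [on compl]] [eig bd]]]].
exists (fun k n => phi k (n + v)); exists (fun k => c k - v); split; [|split].
- split; first by move=> k; exact: is_l2_shift.
  split=> [k l|u l2u uk]; first by rewrite inner_shift.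
  have u0 : (fun n => u (n - v)) = fun=> 0.
    apply: compl => [|k]; first exact: (is_l2_shift (- v)).
    rewrite -(inner_shift v); [|exact: (is_l2_shift (- v))|exact: l2].
    have -> : (fun n => u (n + v - v)) = u by apply/funext => n; rewrite addrK.
    exact: uk.
  by apply/funext => n; have := congr1 (@^~ (n + v)) u0; rewrite /= addrK.
- move=> k; have [_ [nz [E HE]]] := eig k; split; first exact: is_l2_shift.
  split.
    move=> z; apply: nz; apply/funext => n.
    by have := congr1 (@^~ (n - v)) z; rewrite /= subrK.
  exists E => n; rewrite -HE /schrodinger; congr (_ + _).
  by apply: eq_bigr => i _; rewrite (addrAC n (unitv i)) (addrAC n (- unitv i)).
- move=> k m; have -> : m - (c k - v) = m + v - c k by rewrite opprB addrA.
  exact: (bd k (m + v)).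
Qed.

Lemma ULE_weaken H (alpha alpha' C C' : R) : alpha' <= alpha -> C <= C' ->
  ULE_with (g := g) H alpha C -> ULE_with H alpha' C'.
Proof.
move=> aa CC [phi [c [co [eig bd]]]]; exists phi; exists c; split=> //; split=> // k m.
apply: le_trans (bd k m) _; apply: (@le_trans _ _ (C' * expR (- alpha * (l1norm (m - c k))%:~R))).
  by rewrite ler_wpM2r // expR_ge0.
apply: ler_wpM2l; first exact: le_trans (bound_ge0 _ _ _ _ (bd 0%N)) CC.
by rewrite ler_expR ler_wpM2r ?lerN2 // ler0z l1norm_ge0.
Qed.

End Translation.

(** * The lattice action generated by the commuting maps *)

Section Action.
Context {X : Type} {g : nat} (T Tinv : 'I_g -> X -> X).
Hypotheses (TK : forall i, cancel (T i) (Tinv i)) (TinvK : forall i, cancel (Tinv i) (T i)).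
Hypothesis (comm : forall i j, T i \o T j = T j \o T i).

Lemma zpowS (S Sinv : X -> X) k x : cancel S Sinv -> zpow S Sinv (k + 1) x = zpow S Sinv k (S x).
Proof.
move=> SK; case: k => [p|[|p]].
- by rewrite -PoszD addn1 /= -iterSr.
(* [Negz 0] is -1: the added step cancels the single inverse. *)
- by rewrite /= SK.
- have -> : Negz p.+1 + 1 = Negz p by rewrite !NegzE (intS p.+1) opprD addrAC addNr add0r.
  by rewrite /zpow [in RHS]iterSr SK.
Qed.

Lemma zpow_comm i j k x : T i (zpow (T j) (Tinv j) k x) = zpow (T j) (Tinv j) k (T i x).
Proof.
have cT y : T i (T j y) = T j (T i y) by exact: (congr1 (@^~ y) (comm i j)).
have cTinv y : T i (Tinv j y) = Tinv j (T i y).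
  by apply: (can_inj (TK j)); rewrite TinvK -cT TinvK.
case: k => p; rewrite /zpow.
  by elim: p => //= p <-.
by elim: p.+1 => //= q <-.
Qed.

(** Only the factor of index [i] changes, and it occurs once in the enumeration; commutation carries
    the extra [T i] through the factors applied before it. *)
Lemma zact_succ i n x : zact T Tinv (n + unitv i) x = zact T Tinv n (T i x).
Proof.
rewrite /zact; have us := enum_uniq 'I_g; have : i \in enum 'I_g by rewrite mem_enum.
set F := fun _ _ => _; set G := fun _ _ => _.
have GT s y : foldr G (T i y) s = T i (foldr G y s).
  by elim: s => //= j s ->; rewrite /G zpow_comm.
have FG s y : i \notin s -> foldr F y s = foldr G y s.
  elim: s => //= j s IH; rewrite inE negb_or => /andP[ij /IH ->].
  by rewrite /F /G !ffunE eq_sym (negPf ij) addr0.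
elim: (enum 'I_g) us => //= j s IH /andP[js us]; rewrite inE => /orP[/eqP ij|si].
  rewrite -ij in js *; rewrite (FG _ _ js) GT {1}/F /G.
  have -> : (n + unitv i) i = n i + 1 by rewrite !ffunE eqxx.
  by rewrite zpowS.
rewrite IH // /F /G !ffunE; have /negPf -> : j != i by apply: contraNneq js => ->.
by rewrite addr0.
Qed.

End Action.

Lemma zact_continuous {X : topologicalType} {g : nat} (T Tinv : 'I_g -> X -> X) n :
  (forall i, continuous (T i)) -> (forall i, continuous (Tinv i)) ->
  continuous (zact T Tinv n).
Proof.
move=> cT cTinv; rewrite /zact; elim: (enum 'I_g) => [|i s IH] /=; first by move=> x; exact: cvg_id.
have cit (S : X -> X) p : continuous S -> continuous (iter p S).
  move=> cS; elim: p => [|p IHp] /= x; first exact: cvg_id.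
  by apply: (continuous_comp (IHp x)); exact: cS.
move=> x; apply: (continuous_comp (IH x)).
by case: (n i) => p; exact: (cit _ _ _).
Qed.

(** * Invariance and closedness of the sets with given constants *)

Section Main.
Context {R : realType} {X : ptopologicalType} {g : nat} (T Tinv : 'I_g -> X -> X).
Hypotheses (homeo : forall i, [/\ continuous (T i), continuous (Tinv i),
                        cancel (T i) (Tinv i) & cancel (Tinv i) (T i)])
  (commute : forall i j, T i \o T j = T j \o T i).
Variable f : X -> R.
Hypothesis fcont : continuous f.

Definition ULE_set (alpha C : R) : set X := [set w | ULE_with (Hop T Tinv f w) alpha C].

(** Moving [w] to [T i w] translates the potential by [unitv i], which preserves both constants; the
    two inclusions use opposite shifts. *)
Lemma ULE_set_invariant alpha C i : T i @^-1` ULE_set alpha C = ULE_set alpha C.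
Proof.
have E w n : zact T Tinv n (T i w) = zact T Tinv (n + unitv i) w.
  by rewrite zact_succ // => j; case: (homeo j).
apply/seteqP; split=> w.
  move=> /(ULE_shift (- unitv i) (fun n => f (zact T Tinv n (T i w)))).
  rewrite /ULE_set /= (_ : (fun n => _) = fun n => f (zact T Tinv n w)) //.
  by apply/funext => n; rewrite E subrK.
move=> /(ULE_shift (unitv i) (fun n => f (zact T Tinv n w))).
rewrite /ULE_set /= (_ : (fun n => _) = fun n => f (zact T Tinv n (T i w))) //.
by apply/funext => n; rewrite E.
Qed.

Lemma ULE_set_closed alpha C : 0 < alpha -> closed (ULE_set alpha C).
Proof.
move=> a0 w clw; have [N HN] := frame_of_ULE (g := g) alpha C a0.
have PF := within_nbhs_proper clw.
(* [U] refines the neighbourhoods of [w] within the set, so the potentials converge pointwise along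
   it by continuity of [f] and of the action. *)
have [U [UU sU]] := ultraFilterLemma PF.
have UA : U (ULE_set alpha C) by apply: sU; exact: withinT.
have g0 : (0 < g)%N by have [x /ULE_dim_gt0] := filter_ex UA.
have [||psi fr] := frame_lim U (fun x n => f (zact T Tinv n x)) (fun n => f (zact T Tinv n w)) alpha C N a0.
- move=> n B fB; apply: sU.
  have cz : continuous (zact T Tinv n) by apply: zact_continuous => i; case: (homeo i).
  have : nbhs w [set x | B (f (zact T Tinv n x))].
    exact: (continuous_comp (cz w) (fcont _) fB).
  by apply: filterS => x h _; exact: h.
- by apply: filterS UA => x /HN.
exact: ULE_of_frame g0 a0 fr.
Qed.

End Main.

(** * Measurability and the ergodicity argument *)

Lemma closed_measurable_open (X : ptopologicalType) (A : set (g_sigma_algebraType (@open X))) :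
  closed (A : set X) -> measurable A.
Proof.
move=> cA; rewrite -(setCK A); apply: measurableC; apply: sub_sigma_algebra.
exact: closed_openC.
Qed.

Theorem theorem1p1 (R : realType) (X : ptopologicalType) (g : nat)
  (T Tinv : 'I_g -> X -> X)
  (homeo : forall i, [/\ continuous (T i), continuous (Tinv i),
                        cancel (T i) (Tinv i) & cancel (Tinv i) (T i)])
  (commute : forall i j, T i \o T j = T j \o T i)
  (mu : {measure set (g_sigma_algebraType (@open X)) -> \bar R})
  (erg : ergodic T mu)
  (f : X -> R) (fcont : continuous f) :
  (exists S : set (g_sigma_algebraType (@open X)),
      measurable S /\ (0 < mu S)%E /\ forall w, S w -> ULE (Hop T Tinv f w)) ->
  exists alpha C : R, 0 < alpha /\ 0 < C /\
    forall w, msupport mu w -> ULE_with (Hop T Tinv f w) alpha C.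
Proof.
move=> [S [mS [S0 SULE]]].
pose A k : set (g_sigma_algebraType (@open X)) := ULE_set T Tinv f k.+1%:R^-1 k.+1%:R.
have A_closed k : closed (A k : set X) by apply: ULE_set_closed.
have mA k : measurable (A k) by exact: closed_measurable_open.
have [k Ak] : exists k, mu (A k) != 0%E.
  apply: contrapT => nA.
  have A0 k : mu (A k) = 0%E by apply: contrapT => /eqP h; apply: nA; exists k.
  have SA : S `<=` \bigcup_k A k.
    move=> w /SULE [alpha [C [a0 [C0 ule]]]].
    (* Both summands are positive, so a bound on the sum gives [C <= k.+1%:R] and
       [k.+1%:R^-1 <= alpha] together. *)
    pose k := Num.bound (C + alpha^-1).
    have ai0 : 0 < alpha^-1 by rewrite invr_gt0.
    have kb : C + alpha^-1 < k.+1%:R.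
      apply: (@lt_trans _ _ k%:R); last by rewrite ltr_nat.
      by apply: archi_boundP; rewrite addr_ge0 // ltW.
    exists k => //; apply: ULE_weaken ule; last by lra.
    by rewrite invf_ple ?posrE //; lra.
  have := measure_sigma_subadditive mu mA mS SA.
  by rewrite eseries0 ?leNgt ?S0 // => i _ _; exact: A0.
exists k.+1%:R^-1; exists k.+1%:R; split; [by rewrite invr_gt0|split=> // w sw].
have [mA0|mCA0] := erg.2 (A k) (mA k) (fun i => ULE_set_invariant T Tinv homeo commute f _ _ i).
  by rewrite mA0 eqxx in Ak.
(* Outside [A k], the point would have an open null neighbourhood, against membership in the
   support. *)
apply: contrapT => nAw; have := sw (~` A k) (closed_openC (A_closed k)) nAw.
by rewrite mCA0 ltxx.
Qed.
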